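(* For any p-points $a_1$ and $a_2$, $$\frac{1}{q^b(a_1,a_2)}+\frac{1}{q^r(a_1,a_2)}+\frac{1}{q^g(a_1,a_2)}=2,$$ where $q^b$, $q^r$ and $q^g$ are the blue, red and green p-quadrances.
   Context: Fix a field of characteristic not two. A p-point (projective point) is a proportion $[x:y]$ with $x,y$ in the field not both zero, where $[x_1:y_1]=[x_2:y_2]$ precisely when $x_1y_2-x_2y_1=0$. A p-point $[x:y]$ is blue null when $x^2+y^2=0$, red null when $x^2-y^2=0$, and green null when $2xy=0$; otherwise it is non-null for the respective colour. The p-quadrance of each colour is defined between p-points that are non-null for that colour. For $a_1=[x_1:y_1]$ and $a_2=[x_2:y_2]$, the blue, red and green p-quadrances are $$q^b(a_1,a_2)=\frac{(x_1y_2-x_2y_1)^2}{(x_1^2+y_1^2)(x_2^2+y_2^2)},\qquad q^r(a_1,a_2)=-\frac{(x_1y_2-x_2y_1)^2}{(x_1^2-y_1^2)(x_2^2-y_2^2)},\qquad q^g(a_1,a_2)=-\frac{(x_1y_2-x_2y_1)^2}{4x_1y_1x_2y_2}.$$ *)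

(* Defs.v *)
From mathcomp Require Import all_boot all_order all_algebra.
From mathcomp Require Import ring.

Set Implicit Arguments.
Unset Strict Implicit.
Unset Printing Implicit Defensive.

Import GRing.Theory.
Local Open Scope ring_scope.
Local Open Scope quotient_scope.

Section PPoints.
Variable F : fieldType.

Definition pcoord : Type := {u : F * F | (u.1 != 0) || (u.2 != 0)}.

Definition px (u : pcoord) : F := (val u).1.
Definition py (u : pcoord) : F := (val u).2.

Definition pdet (u v : pcoord) : F := px u * py v - px v * py u.

Definition same_prop : rel pcoord := fun u v => pdet u v == 0.

Lemma same_prop_refl : reflexive same_prop.
Proof. by move=> u; rewrite /same_prop /pdet subrr. Qed.

Lemma same_prop_sym : symmetric same_prop.
Proof. by move=> u v; rewrite /same_prop /pdet -opprB oppr_eq0. Qed.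

Lemma same_prop_trans : transitive same_prop.
Proof.
move=> v u w; rewrite /same_prop => /eqP uv /eqP vw.
have hx : px v * pdet u w = 0.
  by have -> : px v * pdet u w = px u * pdet v w + px w * pdet u v;
    [rewrite /pdet; ring | rewrite uv vw !mulr0 addr0].
have hy : py v * pdet u w = 0.
  by have -> : py v * pdet u w = py u * pdet v w + py w * pdet u v;
    [rewrite /pdet; ring | rewrite uv vw !mulr0 addr0].
case/orP: (valP v) => [nz|nz].
- by move/eqP: hx; rewrite mulf_eq0 (negPf nz : (px v == 0) = false).
- by move/eqP: hy; rewrite mulf_eq0 (negPf nz : (py v == 0) = false).
Qed.

Canonical same_prop_equiv :=
  EquivRel same_prop same_prop_refl same_prop_sym same_prop_trans.

Definition ppoint : Type := {eq_quot same_prop}.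

(* The p-point [x : y]. *)
Definition ppt (x y : F) (nz : (x != 0) || (y != 0)) : ppoint :=
  \pi_{eq_quot same_prop} (exist _ (x, y) nz : pcoord).

(* The notions below are read off the canonical representative; the lemmas at
   the end of the section show that every choice of coordinates gives the same
   result. *)
Definition coord (a : ppoint) : pcoord := repr (a : {eq_quot same_prop}).

Definition blue_null (a : ppoint) : bool :=
  let x := px (coord a) in let y := py (coord a) in x ^+ 2 + y ^+ 2 == 0.

Definition red_null (a : ppoint) : bool :=
  let x := px (coord a) in let y := py (coord a) in x ^+ 2 - y ^+ 2 == 0.

Definition green_null (a : ppoint) : bool :=
  let x := px (coord a) in let y := py (coord a) in 2 * x * y == 0.

(* Division by zero makes the p-quadrances total functions; they are only
   meaningful between p-points that are non-null for the colour. *)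
Definition qb (a1 a2 : ppoint) : F :=
  let x1 := px (coord a1) in let y1 := py (coord a1) in
  let x2 := px (coord a2) in let y2 := py (coord a2) in
  (x1 * y2 - x2 * y1) ^+ 2 / ((x1 ^+ 2 + y1 ^+ 2) * (x2 ^+ 2 + y2 ^+ 2)).

Definition qr (a1 a2 : ppoint) : F :=
  let x1 := px (coord a1) in let y1 := py (coord a1) in
  let x2 := px (coord a2) in let y2 := py (coord a2) in
  - ((x1 * y2 - x2 * y1) ^+ 2 / ((x1 ^+ 2 - y1 ^+ 2) * (x2 ^+ 2 - y2 ^+ 2))).

Definition qg (a1 a2 : ppoint) : F :=
  let x1 := px (coord a1) in let y1 := py (coord a1) in
  let x2 := px (coord a2) in let y2 := py (coord a2) in
  - ((x1 * y2 - x2 * y1) ^+ 2 / (4 * x1 * y1 * x2 * y2)).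

Lemma ppointP (a : ppoint) : exists x y nz, a = @ppt x y nz.
Proof.
exists (px (coord a)), (py (coord a)), (valP (coord a)).
rewrite /ppt -[LHS](reprK (a : {eq_quot same_prop})).
by apply/eqP; rewrite eqmodE /= /same_prop /pdet /px /py /= subrr.
Qed.

Lemma ppt_eqE x1 y1 nz1 x2 y2 nz2 :
  (@ppt x1 y1 nz1 == @ppt x2 y2 nz2) = (x1 * y2 - x2 * y1 == 0).
Proof. by rewrite /ppt eqmodE. Qed.

Lemma coord_ppt x y nz : exists2 k, k != 0 &
  px (coord (@ppt x y nz)) = k * x /\ py (coord (@ppt x y nz)) = k * y.
Proof.
have : same_prop (coord (ppt nz)) (exist _ (x, y) nz).
  by rewrite -[same_prop _ _]eqmodE /coord reprK.
move: (coord (ppt nz)) => u.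
rewrite /same_prop /pdet {2}/px {1}/py /= subr_eq0 => /eqP e.
case: (eqVneq x 0) nz e => [-> /=|x0 nz e]; last first.
  have ey : py u = px u / x * y.
    by apply: (mulfI x0); rewrite -e; field.
  exists (px u / x); last by split=> //; field.
  apply/eqP => k0; have /orP[/negP[]|/negP[]] := valP u.
    by apply/eqP; rewrite -[LHS](divfK x0) k0 mul0r.
  by apply/eqP; rewrite [LHS]ey k0 mul0r.
rewrite mul0r => y0 e.
have xu : px u = 0 by move/eqP: e; rewrite mulf_eq0 (negPf y0) orbF => /eqP.
exists (py u / y); last by rewrite xu mulr0 divfK.
rewrite mulf_neq0 ?invr_neq0 //; have := valP u.
by rewrite (_ : (val u).1 = 0) // eqxx.
Qed.

Lemma blue_null_ppt x y nz : blue_null (@ppt x y nz) = (x ^+ 2 + y ^+ 2 == 0).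
Proof.
rewrite /blue_null /=; have [k k0 [-> ->]] := coord_ppt nz.
by rewrite !exprMn -mulrDr mulf_eq0 expf_eq0 /= (negPf k0).
Qed.

Lemma red_null_ppt x y nz : red_null (@ppt x y nz) = (x ^+ 2 - y ^+ 2 == 0).
Proof.
rewrite /red_null /=; have [k k0 [-> ->]] := coord_ppt nz.
by rewrite !exprMn -mulrBr mulf_eq0 expf_eq0 /= (negPf k0).
Qed.

Lemma green_null_ppt x y nz : green_null (@ppt x y nz) = (2 * x * y == 0).
Proof.
rewrite /green_null /=; have [k k0 [-> ->]] := coord_ppt nz.
have -> : 2 * (k * x) * (k * y) = k ^+ 2 * (2 * x * y) by ring.
by rewrite mulf_eq0 expf_eq0 /= (negPf k0).
Qed.

Let scale_frac (c n d : F) : c != 0 -> (c * n) / (c * d) = n / d.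
Proof. by move=> c0; rewrite -mulf_div divff // mul1r. Qed.

Lemma qb_ppt x1 y1 nz1 x2 y2 nz2 :
  qb (@ppt x1 y1 nz1) (@ppt x2 y2 nz2)
  = (x1 * y2 - x2 * y1) ^+ 2 / ((x1 ^+ 2 + y1 ^+ 2) * (x2 ^+ 2 + y2 ^+ 2)).
Proof.
rewrite /qb /=; have [k k0 [-> ->]] := coord_ppt nz1.
have [l l0 [-> ->]] := coord_ppt nz2.
rewrite -[RHS](@scale_frac ((k * l) ^+ 2)) ?expf_neq0 ?mulf_neq0 //.
by congr (_ / _); ring.
Qed.

Lemma qr_ppt x1 y1 nz1 x2 y2 nz2 :
  qr (@ppt x1 y1 nz1) (@ppt x2 y2 nz2)
  = - ((x1 * y2 - x2 * y1) ^+ 2 / ((x1 ^+ 2 - y1 ^+ 2) * (x2 ^+ 2 - y2 ^+ 2))).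
Proof.
rewrite /qr /=; have [k k0 [-> ->]] := coord_ppt nz1.
have [l l0 [-> ->]] := coord_ppt nz2.
rewrite -[in RHS](@scale_frac ((k * l) ^+ 2)) ?expf_neq0 ?mulf_neq0 //.
by congr (- (_ / _)); ring.
Qed.

Lemma qg_ppt x1 y1 nz1 x2 y2 nz2 :
  qg (@ppt x1 y1 nz1) (@ppt x2 y2 nz2)
  = - ((x1 * y2 - x2 * y1) ^+ 2 / (4 * x1 * y1 * x2 * y2)).
Proof.
rewrite /qg /=; have [k k0 [-> ->]] := coord_ppt nz1.
have [l l0 [-> ->]] := coord_ppt nz2.
rewrite -[in RHS](@scale_frac ((k * l) ^+ 2)) ?expf_neq0 ?mulf_neq0 //.
by congr (- (_ / _)); ring.
Qed.

End PPoints.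

(* Main.v *)
Require Import Defs.
From mathcomp Require Import all_boot all_order all_algebra.
From mathcomp Require Import ring.

Import GRing.Theory.
Local Open Scope ring_scope.

(** The numerators of the three p-quadrances are, up to sign, the square of the
    same determinant [D = x1 * y2 - x2 * y1], so their reciprocals are fractions
    with common denominator [D ^+ 2]. The statement then reduces to
    [tricolour_forms], an identity between the numerators of these reciprocals.
    The common denominator does not vanish because [D = 0] is precisely equality
    of the two p-points ([ppt_eqE]). *)

(** The blue product minus the red one keeps twice the mixed terms
    [x1 ^+ 2 * y2 ^+ 2] and [x2 ^+ 2 * y1 ^+ 2]; the green product completes
    their sum to twice a square. *)
Lemma tricolour_forms (R : comPzRingType) (x1 y1 x2 y2 : R) :
  (x1 ^+ 2 + y1 ^+ 2) * (x2 ^+ 2 + y2 ^+ 2)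
  - (x1 ^+ 2 - y1 ^+ 2) * (x2 ^+ 2 - y2 ^+ 2) - 4 * x1 * y1 * x2 * y2
  = 2 * (x1 * y2 - x2 * y1) ^+ 2.
Proof. by ring. Qed.

Theorem theorem11 (F : fieldType) (charF : 2%N \notin [pchar F])
    (a1 a2 : ppoint F)
    (nb1 : ~~ blue_null a1) (nb2 : ~~ blue_null a2)
    (nr1 : ~~ red_null a1) (nr2 : ~~ red_null a2)
    (ng1 : ~~ green_null a1) (ng2 : ~~ green_null a2)
    (a12 : a1 <> a2) :
  1 / qb a1 a2 + 1 / qr a1 a2 + 1 / qg a1 a2 = 2.
Proof.
have [x1 [y1 [nz1 e1]]] := ppointP a1; have [x2 [y2 [nz2 e2]]] := ppointP a2.
have D0 : x1 * y2 - x2 * y1 != 0.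
  by rewrite -(ppt_eqE nz1 nz2) -e1 -e2; apply/eqP.
rewrite e1 e2 qb_ppt qr_ppt qg_ppt !div1r !invrN !invf_div -!mulrBl.
by rewrite tricolour_forms mulfK // expf_neq0.
Qed.
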